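(* For any integers $k\ge 1$ and $n\ge 3$, the free algebra $\mathbf{F}_{\mathsf{V}(\mathbf{M}_n')}(k)$ on $k$ free generators in the variety $\mathsf{V}(\mathbf{M}_n')$ is isomorphic to $$(\mathbf{M}_n')^q\times\mathbf{2}^{2^k}\quad\text{with}\quad q=\frac{(n+2)^k-2^k}{n}.$$ In particular, $\mathbf{F}_{\mathsf{V}(\mathbf{M}_n')}(1)$ is isomorphic to $\mathbf{M}_n'\times\mathbf{2}^2$.
   Context: A lattice with complementation is an algebra $(L,\vee,\wedge,{}',0,1)$ of type $(2,2,1,0,0)$ such that $(L,\vee,\wedge,0,1)$ is a bounded lattice and $a\vee a'=1$, $a\wedge a'=0$ for all $a\in L$. For an integer $n\ge 2$, $\mathbf{M}_n'$ is the lattice with complementation with universe $\{0,1,a_0,\dots,a_{n-1}\}$ (of size $n+2$), where $a_0,\dots,a_{n-1}$ form an antichain, $a_i\vee a_j=1$ and $a_i\wedge a_j=0$ for $i\neq j$, and $0'=1$, $1'=0$, $a_i'=a_{i+1}$ with $i+1$ taken modulo $n$. $\mathsf{V}(\mathbf{A})$ denotes the variety generated by the algebra $\mathbf{A}$. $\mathbf{2}$ denotes the two-element Boolean algebra, viewed as a lattice with complementation. *)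

(* Defs.v *)
From mathcomp Require Import all_boot.

Set Implicit Arguments.
Unset Strict Implicit.
Unset Printing Implicit Defensive.

(** Algebras of type (2,2,1,0,0).  The library's lattice types carry a
    decidable order on a [choiceType]; a variety has to range over algebras on
    arbitrary carriers, so the operations are bundled directly. *)

Record algebra := Algebra {
  carrier :> Type;
  join : carrier -> carrier -> carrier;
  meet : carrier -> carrier -> carrier;
  compl : carrier -> carrier;
  bot : carrier;
  top : carrier }.

Arguments join {a} x y : rename.
Arguments meet {a} x y : rename.
Arguments compl {a} x : rename.
Arguments bot {a} : rename.
Arguments top {a} : rename.

Record lattice_with_complementation (L : algebra) : Prop := {
  joinC : commutative (@join L);
  meetC : commutative (@meet L);
  joinA : associative (@join L);
  meetA : associative (@meet L);
  joinK : forall a b : L, meet a (join a b) = a;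
  meetK : forall a b : L, join a (meet a b) = a;
  join_bot : left_id bot (@join L);
  meet_top : left_id top (@meet L);
  join_compl : forall a : L, join a (compl a) = top;
  meet_compl : forall a : L, meet a (compl a) = bot }.

Record hom (A B : algebra) (h : A -> B) : Prop := {
  hom_join : {morph h : x y / join x y};
  hom_meet : {morph h : x y / meet x y};
  hom_compl : {morph h : x / compl x};
  hom_bot : h bot = bot;
  hom_top : h top = top }.

Definition isomorphic (A B : algebra) : Prop :=
  exists h : A -> B, hom h /\ bijective h.

Definition product (I : Type) (A : I -> algebra) : algebra := {|
  carrier := forall i, A i;
  join := fun x y i => join (x i) (y i);
  meet := fun x y i => meet (x i) (y i);
  compl := fun x i => compl (x i);
  bot := fun=> bot;
  top := fun=> top |}.

Definition power (A : algebra) (q : nat) : algebra :=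
  product (fun _ : 'I_q => A).

Definition product2 (A B : algebra) : algebra := {|
  carrier := A * B;
  join := fun x y => (join x.1 y.1, join x.2 y.2);
  meet := fun x y => (meet x.1 y.1, meet x.2 y.2);
  compl := fun x => (compl x.1, compl x.2);
  bot := (bot, bot);
  top := (top, top) |}.

(** Subalgebras are taken up to isomorphism, as images of injective
    homomorphisms; closure under isomorphism is part of [variety_H]. *)
Record variety (K : algebra -> Prop) : Prop := {
  variety_H : forall (A B : algebra) (h : A -> B),
    hom h -> (forall b, exists a, h a = b) -> K A -> K B;
  variety_S : forall (A B : algebra) (h : B -> A),
    hom h -> injective h -> K A -> K B;
  variety_P : forall (I : Type) (A : I -> algebra),
    (forall i, K (A i)) -> K (product A) }.

Definition variety_generated_by (A B : algebra) : Prop :=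
  forall K : algebra -> Prop, variety K -> K A -> K B.

Record subuniverse (A : algebra) (S : A -> Prop) : Prop := {
  sub_join : forall x y, S x -> S y -> S (join x y);
  sub_meet : forall x y, S x -> S y -> S (meet x y);
  sub_compl : forall x, S x -> S (compl x);
  sub_bot : S bot;
  sub_top : S top }.

Definition generates (X : Type) (A : algebra) (g : X -> A) : Prop :=
  forall S : A -> Prop, subuniverse S -> (forall x, S (g x)) -> forall a, S a.

Record freely_generated (K : algebra -> Prop) (X : Type) (F : algebra)
    (g : X -> F) : Prop := {
  free_mem : K F;
  free_generates : generates g;
  free_extend : forall (B : algebra) (f : X -> B), K B ->
    exists h : F -> B, hom h /\ forall x, h (g x) = f x }.

Inductive Mn_carrier (n : nat) : Type :=
  | Mn_bot
  | Mn_top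
  | Mn_atom of 'I_n.

Arguments Mn_bot {n}.
Arguments Mn_top {n}.

Definition Mn_join n (x y : Mn_carrier n) : Mn_carrier n :=
  match x, y with
  | Mn_bot, z | z, Mn_bot => z
  | Mn_top, _ | _, Mn_top => Mn_top
  | Mn_atom i, Mn_atom j => if i == j then Mn_atom i else Mn_top
  end.

Definition Mn_meet n (x y : Mn_carrier n) : Mn_carrier n :=
  match x, y with
  | Mn_top, z | z, Mn_top => z
  | Mn_bot, _ | _, Mn_bot => Mn_bot
  | Mn_atom i, Mn_atom j => if i == j then Mn_atom i else Mn_bot
  end.

(** [ordS i] has value [i.+1 %% n]. *)
Definition Mn_compl n (x : Mn_carrier n) : Mn_carrier n :=
  match x with
  | Mn_bot => Mn_top
  | Mn_top => Mn_bot
  | Mn_atom i => Mn_atom (ordS i)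
  end.

Definition Mn (n : nat) : algebra := {|
  carrier := Mn_carrier n;
  join := @Mn_join n;
  meet := @Mn_meet n;
  compl := @Mn_compl n;
  bot := Mn_bot;
  top := Mn_top |}.

Definition two : algebra := {|
  carrier := bool;
  join := orb;
  meet := andb;
  compl := negb;
  bot := false;
  top := true |}.

Lemma ordS_neq n (i : 'I_n) : 1 < n -> i == ordS i = false.
Proof.
move=> n_gt1; apply/eqP => /(congr1 val) /= /eqP; rewrite eq_sym.
have [lt_in|le_ni] := ltnP i.+1 n; first by rewrite modn_small // eqn_leq ltnn.
have -> : i.+1 = n by apply/eqP; rewrite eqn_leq ltn_ord.
rewrite modnn => /eqP i0; move: le_ni; rewrite -i0.
by rewrite leqNgt n_gt1.
Qed.

Lemma Mn_lattice_with_complementation n :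
  1 < n -> lattice_with_complementation (Mn n).
Proof.
move=> n_gt1; split => /=.
- by case=> [||i] [||j] //=; rewrite eq_sym; case: eqP => // ->.
- by case=> [||i] [||j] //=; rewrite eq_sym; case: eqP => // ->.
- case=> [||i] [||j] [||k] //=; try by case: eqP.
  have [->|nij] := eqVneq i j; have [<-|njk] := eqVneq j k;
    by rewrite /= ?eqxx ?(negPf nij) ?(negPf njk).
- case=> [||i] [||j] [||k] //=; try by case: eqP.
  have [->|nij] := eqVneq i j; have [<-|njk] := eqVneq j k;
    by rewrite /= ?eqxx ?(negPf nij) ?(negPf njk).
- by case=> [||i] [||j] //=; rewrite ?eqxx //; case: eqP => //= _; rewrite eqxx.
- by case=> [||i] [||j] //=; rewrite ?eqxx //; case: eqP => //= _; rewrite eqxx.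
- by case.
- by case.
- by case=> [||i] //=; rewrite ordS_neq.
- by case=> [||i] //=; rewrite ordS_neq.
Qed.

Lemma two_lattice_with_complementation : lattice_with_complementation two.
Proof. by split=> [[] []|[] []|[] [] []|[] [] []|[] []|[] []|[]|[]|[]|[]]. Qed.

(* Main.v *)
(** The free algebra is the subalgebra of a power of [Mn n] generated by the
    assignments [k -> Mn n].  The [2 ^ k] Boolean assignments contribute factors
    [two]; the others fall into orbits of size [n] under the cyclic automorphism
    group of [Mn n], and one coordinate per orbit suffices.  Since [n >= 3], two
    coordinates not related by an automorphism are separated by a term taking
    the values 1 and 0 there, so the generated subalgebra is the full product. *)

Require Import Defs.
From Stdlib Require Import Classical FunctionalExtensionality.
From Stdlib Require Import IndefiniteDescription.
From HB Require Import structures.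
From mathcomp Require Import all_boot.
From mathcomp Require Import ssralg zmodp.

Set Implicit Arguments.
Unset Strict Implicit.
Unset Printing Implicit Defensive.

(** * Homomorphisms, products and isomorphisms *)

Lemma comp_hom (A B C : algebra) (h : A -> B) (h' : B -> C) :
  hom h -> hom h' -> hom (h' \o h).
Proof.
by case=> j m c b t [j' m' c' b' t']; split=> [x y|x y|x||] /=;
  rewrite ?j ?m ?c ?b ?t.
Qed.

Lemma hom_pair (A B C : algebra) (h : A -> B) (h' : A -> C) :
  hom h -> hom h' -> hom (B := product2 B C) (fun a => (h a, h' a)).
Proof.
by case=> j m c b t [j' m' c' b' t']; split=> [x y|x y|x||] /=;
  rewrite ?j ?m ?c ?b ?t ?j' ?m' ?c' ?b' ?t'.
Qed.

Lemma hom_prod (I : Type) (A : algebra) (B : I -> algebra)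
    (h : forall i, A -> B i) :
  (forall i, hom (h i)) -> hom (B := product B) (fun a i => h i a).
Proof.
move=> hh; split=> [x y|x y|x||]; apply: functional_extensionality_dep => i /=.
- exact: (hom_join (hh i)).
- exact: (hom_meet (hh i)).
- exact: (hom_compl (hh i)).
- exact: (hom_bot (hh i)).
- exact: (hom_top (hh i)).
Qed.

Lemma hom_fst (A B : algebra) : hom (A := product2 A B) (B := A) fst.
Proof. by []. Qed.

Lemma hom_snd (A B : algebra) : hom (A := product2 A B) (B := B) snd.
Proof. by []. Qed.

Lemma hom_eval (I : Type) (A : I -> algebra) i :
  hom (A := product A) (B := A i) (fun a => a i).
Proof. by []. Qed.

Lemma isomorphic_refl A : isomorphic A A.
Proof. by exists id; split=> //; exists id. Qed.

Lemma isomorphic_trans A B C :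
  isomorphic A B -> isomorphic B C -> isomorphic A C.
Proof.
move=> [h [hh bh]] [h' [hh' bh']]; exists (h' \o h).
by split; [apply: comp_hom | apply: bij_comp].
Qed.

Lemma isomorphic_product2 A B A' B' :
  isomorphic A A' -> isomorphic B B' ->
  isomorphic (product2 A B) (product2 A' B').
Proof.
move=> [h [hh [k hk kh]]] [h' [hh' [k' hk' kh']]].
exists (fun x => (h x.1, h' x.2)); split.
  apply: (hom_pair (A := product2 A B) (h := h \o fst) (h' := h' \o snd)).
    exact: comp_hom (@hom_fst _ _) hh.
  exact: comp_hom (@hom_snd _ _) hh'.
by exists (fun x => (k x.1, k' x.2)) => -[x y] /=; rewrite ?hk ?hk' ?kh ?kh'.
Qed.

Lemma isomorphic_reindex (I J : Type) (A : algebra) (e : J -> I) :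
  bijective e -> isomorphic (product (fun _ : I => A)) (product (fun _ : J => A)).
Proof.
case=> d ed de; exists (fun x j => x (e j)); split.
  by apply: (hom_prod (h := fun j (x : product (fun _ : I => A)) => x (e j))).
by exists (fun x i => x (d i)) => x; apply: functional_extensionality => i;
  rewrite ?ed ?de.
Qed.

Lemma isomorphic_power1 A : isomorphic (power A 1) A.
Proof.
exists (fun x : power A 1 => x ord0); split=> //.
exists (fun a => (fun=> a) : power A 1) => // x.
by apply: functional_extensionality => i; rewrite (ord1 i).
Qed.

Lemma isomorphic_power (I : finType) (A : algebra) q :
  #|I| = q -> isomorphic (product (fun _ : I => A)) (power A q).
Proof.
move=> <-; apply: (isomorphic_reindex _ (e := @enum_val I predT)).
exact: enum_val_bij.
Qed.

(** * Subuniverses and uniqueness of free algebras *)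

Lemma subuniverse_image (A B : algebra) (h : A -> B) (S : A -> Prop) :
  hom h -> subuniverse S -> subuniverse (fun b => exists2 a, S a & h a = b).
Proof.
move=> [j m c b t] [Sj Sm Sc Sb St]; split.
- by move=> _ _ [x Sx <-] [y Sy <-]; exists (join x y); [exact: Sj | exact: j].
- by move=> _ _ [x Sx <-] [y Sy <-]; exists (meet x y); [exact: Sm | exact: m].
- by move=> _ [x Sx <-]; exists (compl x); [exact: Sc | exact: c].
- by exists bot.
- by exists top.
Qed.

Lemma subuniverse_equalizer (A B : algebra) (h h' : A -> B) :
  hom h -> hom h' -> subuniverse (fun a => h a = h' a).
Proof.
case=> j m c b t [j' m' c' b' t']; split=> [x y|x y|x||].
- by rewrite j j' => -> ->.
- by rewrite m m' => -> ->.
- by rewrite c c' => ->.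
- by rewrite b b'.
- by rewrite t t'.
Qed.

Lemma subuniverse_iter_compl (A : algebra) (S : A -> Prop) c a :
  subuniverse S -> S a -> S (iter c compl a).
Proof. by move=> sS Sa; elim: c => //= c; apply: sub_compl. Qed.

(** Both round trips fix the generators, so the equalizer with the identity, being a subuniverse, is
    everything. *)
Lemma free_unique (K : algebra -> Prop) X (F F' : algebra)
    (g : X -> F) (g' : X -> F') :
  freely_generated K g -> freely_generated K g' -> isomorphic F F'.
Proof.
move=> [KF gF eF] [KF' gF' eF'].
have [h [hh hg]] := eF _ g' KF'; have [h' [hh' hg']] := eF' _ g KF.
exists h; split=> //; exists h' => a.
  apply: (gF (fun a => h' (h a) = a)); last by move=> x; rewrite hg hg'.
  exact: subuniverse_equalizer (comp_hom hh hh') _.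
apply: (gF' (fun a => h (h' a) = a)); last by move=> x; rewrite hg' hg.
exact: subuniverse_equalizer (comp_hom hh' hh) _.
Qed.

Lemma variety_product2 K A B : variety K -> K A -> K B -> K (product2 A B).
Proof.
move=> vK KA KB.
(* Varieties are closed under indexed products only, so the pair is obtained from a product over
   [bool]. *)
pose C (b : bool) := if b then A else B.
pose h (x : product C) : product2 A B := (x true, x false).
apply: (variety_H vK (A := product C) (h := h)).
- by apply: (hom_pair (h := fun x : product C => x true)
                      (h' := fun x : product C => x false)); apply: hom_eval.
- move=> [a b].
  by exists (fun c => match c return C c with true => a | false => b end).
- by apply: (variety_P vK); case.
Qed.

(** * Reduction of freeness to maps into the generating algebra *)

Definition extends_to X (P : algebra) (g : X -> P) (B : algebra) :=
  forall f : X -> B, exists h : P -> B, hom h /\ forall x, h (g x) = f x.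

(** With this, the extension property need only be checked for the algebra that generates the
    variety. *)
Lemma extends_to_variety X (P : algebra) (g : X -> P) :
  generates g -> variety (extends_to g).
Proof.
move=> gP; split.
- move=> A B h hh hsurj KA f.
  have [f' f'E] : exists f' : X -> A, forall x, h (f' x) = f x.
    by apply: (functional_choice (fun x a => h a = f x)) => x; apply: hsurj.
  have [h' [hh' h'E]] := KA f'.
  by exists (h \o h'); split=> [|x /=]; [apply: comp_hom | rewrite h'E].
- move=> A B h hh hinj KA f.
  have [h' [hh' h'E]] := KA (h \o f).
  (* The elements that [h'] sends into the range of [h] form a subuniverse containing the
     generators, so [h'] factors through [h]. *)
  have [k kE] : exists k : P -> B, forall a, h (k a) = h' a.
    apply: (functional_choice (fun a b => h b = h' a)).
    apply: gP => [|x]; last by exists (f x); rewrite h'E.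
    split.
    + move=> x y [b bE] [b' b'E]; exists (join b b').
      by rewrite (hom_join hh) (hom_join hh') bE b'E.
    + move=> x y [b bE] [b' b'E]; exists (meet b b').
      by rewrite (hom_meet hh) (hom_meet hh') bE b'E.
    + move=> x [b bE]; exists (compl b).
      by rewrite (hom_compl hh) (hom_compl hh') bE.
    + by exists bot; rewrite (hom_bot hh) (hom_bot hh').
    + by exists top; rewrite (hom_top hh) (hom_top hh').
  exists k; split=> [|x]; last by apply: hinj; rewrite kE h'E.
  split=> [x y|x y|x||]; apply: hinj; rewrite kE.
  + by rewrite (hom_join hh) (hom_join hh') !kE.
  + by rewrite (hom_meet hh) (hom_meet hh') !kE.
  + by rewrite (hom_compl hh) (hom_compl hh') !kE.
  + by rewrite (hom_bot hh) (hom_bot hh').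
  + by rewrite (hom_top hh) (hom_top hh').
- move=> I A KA f.
  pose ext i := constructive_indefinite_description _ (KA i (fun x => f x i)).
  exists (fun a i => sval (ext i) a); split.
    by apply: hom_prod => i; case: (svalP (ext i)).
  move=> x; apply: functional_extensionality_dep => i.
  by case: (svalP (ext i)).
Qed.

Lemma freely_generated_variety X (A P : algebra) (g : X -> P) :
  variety_generated_by A P -> generates g -> extends_to g A ->
  freely_generated (variety_generated_by A) g.
Proof.
move=> VP gP gA; split=> // B f VB.
exact: (VB _ (extends_to_variety gP) gA).
Qed.

(* An element [e] of [S] with value [top] at [j] and [bot] elsewhere localizes
   any element of [S] at [j]; finite joins of localized elements give all of [P]. *)
Lemma separating_subuniverse_full (A P : algebra) (J : finType)
    (ev : J -> P -> A) (S : P -> Prop) :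
  lattice_with_complementation A -> (forall j, hom (ev j)) ->
  (forall a b, (forall j, ev j a = ev j b) -> a = b) -> subuniverse S ->
  (forall j l, j != l -> exists e, [/\ S e, ev j e = top & ev l e = bot]) ->
  (forall j a, exists2 p, S p & ev j p = ev j a) ->
  forall a, S a.
Proof.
move=> LA hev inj sS sep onto a.
have meet_bot x : meet bot x = bot :> A by rewrite -{1}(join_bot LA x) joinK.
have joinxx x : join x x = x :> A by rewrite -{2}(joinK LA x x) meetK.
have local j : exists e, [/\ S e, ev j e = top & forall l, l != j -> ev l e = bot].
  suff [e [Se ej el]] : exists e, [/\ S e, ev j e = top &
      forall l, l \in enum J -> l != j -> ev l e = bot].
    by exists e; split=> // l; apply: el; rewrite mem_enum.
  (* Take the meet, over the listed [l] other than [j], of elements separating [j] from [l]. *)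
  elim: (enum J) => [|l s [e [Se ej el]]].
    by exists top; split=> //; [apply: sub_top | apply: hom_top].
  have [->|nlj] := eqVneq l j.
    exists e; split=> // i; rewrite inE => /predU1P[->|]; last exact: el.
    by rewrite eqxx.
  have [|d [Sd dj dl]] := sep j l; first by rewrite eq_sym.
  exists (meet d e); split; first exact: sub_meet.
    by rewrite hom_meet // dj ej meet_top.
  move=> i; rewrite inE hom_meet // => /predU1P[->|/el ei /ei ->].
    by rewrite dl meet_bot.
  by rewrite meetC // meet_bot.
suff [b Sb bE] : exists2 b, S b &
    forall l, ev l b = if l \in enum J then ev l a else bot.
  by rewrite (_ : a = b) //; apply: inj => l; rewrite bE mem_enum.
elim: (enum J) => [|j s [b Sb bE]].
  by exists bot => [|l]; [apply: sub_bot | apply: hom_bot].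
have [e [Se ej el]] := local j; have [p Sp pE] := onto j a.
exists (join (meet e p) b) => [|l].
  by apply: sub_join => //; apply: sub_meet.
rewrite hom_join // hom_meet // inE bE.
have [->|nlj] /= := eqVneq l j; last by rewrite el // meet_bot join_bot.
(* If [j] already occurs in [s], idempotence of join applies. *)
rewrite ej pE meet_top //; case: ifP => // _.
by rewrite joinC // join_bot.
Qed.

(** * Finiteness of [Mn n] and its Boolean part *)

Definition Mn_code n (x : Mn_carrier n) : option (option 'I_n) :=
  match x with
  | Mn_bot => None
  | Mn_top => Some None
  | Mn_atom i => Some (Some i)
  end.

Definition Mn_decode n (x : option (option 'I_n)) : Mn_carrier n :=
  match x with
  | None => Mn_bot
  | Some None => Mn_top
  | Some (Some i) => Mn_atom i
  end.

Lemma Mn_codeK n : cancel (@Mn_code n) (@Mn_decode n).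
Proof. by case. Qed.

Lemma Mn_decodeK n : cancel (@Mn_decode n) (@Mn_code n).
Proof. by case=> [[]|]. Qed.

HB.instance Definition _ n := Finite.copy (Mn_carrier n) (can_type (@Mn_codeK n)).

Lemma card_Mn n : #|{: Mn_carrier n}| = n + 2.
Proof.
rewrite (bij_eq_card (Bijective (@Mn_codeK n) (@Mn_decodeK n))).
by rewrite !card_option card_ord addn2.
Qed.

Definition is_atom n (x : Mn_carrier n) : bool :=
  if x is Mn_atom _ then true else false.

Definition Mn_of_bool n (b : bool) : Mn_carrier n := if b then Mn_top else Mn_bot.

Lemma Mn_of_bool_inj n : injective (@Mn_of_bool n).
Proof. by case=> [] []. Qed.

Lemma Mn_of_bool_hom n : hom (A := two) (B := Mn n) (@Mn_of_bool n).
Proof. by split=> [[] []|[] []|[]||]. Qed.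

Lemma Mn_of_boolK n (x : Mn_carrier n) : ~~ is_atom x -> Mn_of_bool n (x == Mn_top) = x.
Proof. by case: x. Qed.

Import GRing.Theory.

(** * Rotations of the atoms and subuniverses of the square of [Mn n] *)

Section Shift.

Variable m : nat.
(** Writing n as m + 3 makes ['I_n] the ring of integers mod n and builds in n >= 3. *)
Local Notation n := m.+3.
Implicit Types (a b c : 'I_n) (x y : Mn_carrier n).

Lemma ordS_addr a : ordS a = (a + 1)%R.
Proof. by apply: val_inj; rewrite /= addn1. Qed.

Lemma iter_compl_atom (c : nat) a :
  iter c (@compl (Mn n)) (Mn_atom a) = Mn_atom (a + c%:R)%R.
Proof.
elim: c => [|c IHc] /=; first by rewrite addr0.
by rewrite IHc /= ordS_addr -addrA -natr1.
Qed.

Lemma ord_natr a : (a : nat)%:R%R = a.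
Proof. exact: natr_Zp. Qed.

Definition Mn_shift c x : Mn_carrier n :=
  if x is Mn_atom a then Mn_atom (a + c)%R else x.

Lemma is_atom_shift c x : is_atom (Mn_shift c x) = is_atom x.
Proof. by case: x. Qed.

Lemma Mn_shiftD b c x : Mn_shift c (Mn_shift b x) = Mn_shift (b + c)%R x.
Proof. by case: x => //= a; rewrite addrA. Qed.

Lemma Mn_shift0 x : Mn_shift 0%R x = x.
Proof. by case: x => //= a; rewrite addr0. Qed.

(** Complementation rotates the atoms by 1, and rotations commute. *)
Lemma Mn_shift_hom c : hom (A := Mn n) (B := Mn n) (Mn_shift c).
Proof.
split=> //.
- by case=> [||a] [||b] //=; rewrite (inj_eq (addIr c)); case: ifP.
- by case=> [||a] [||b] //=; rewrite (inj_eq (addIr c)); case: ifP.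
- by case=> [||a] //=; rewrite !ordS_addr addrAC.
Qed.

(** Iterated complements of one atom run through all atoms. *)
Lemma atom_generates (S : Mn n -> Prop) a :
  subuniverse S -> S (Mn_atom a) -> forall x, S x.
Proof.
move=> sS Sa [||b]; [exact: sub_bot sS|exact: sub_top sS|].
have := subuniverse_iter_compl (b - a)%R sS Sa.
by rewrite iter_compl_atom ord_natr addrC subrK.
Qed.

(** This is where n >= 3 enters: 2 is nonzero mod n. *)
Lemma two_steps_neq a : (a == ordS (ordS a)) = false.
Proof.
rewrite !ordS_addr -addrA -{1}(addr0 a) (inj_eq (addrI a)).
by apply/negbTE/eqP => /(congr1 val).
Qed.

(* If the relation does not contain (1,0), it is the graph of a partial
   automorphism: 1 and 0 are related to themselves only, since an atom is
   distinct from its second complement ([n >= 3]). *)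
Lemma separation (R : product2 (Mn n) (Mn n) -> Prop) I (s t : I -> Mn n) :
  subuniverse R -> (forall i, R (s i, t i)) ->
  R (top, bot) \/ exists c, forall i, t i = Mn_shift c (s i).
Proof.
move=> sR Rst; have [R10|nR10] := classic (R (top, bot)); [by left|right].
have Rc := sub_compl sR; have Rj := sub_join sR; have Rm := sub_meet sR.
have nR1a a : ~ R (Mn_top, Mn_atom a).
  (* (1,a) meets its double complement (1,a'') in (1,0), because a and a'' are distinct atoms; the
     case (a,0) below is dual, with joins. *)
  by move=> Ra; apply: nR10; have := Rm _ _ Ra (Rc _ (Rc _ Ra));
     rewrite /= two_steps_neq.
have nR0a a : ~ R (Mn_bot, Mn_atom a) by move=> /Rc /nR1a.
have nRa0 a : ~ R (Mn_atom a, Mn_bot).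
  by move=> Ra; apply: nR10; have := Rj _ _ Ra (Rc _ (Rc _ Ra));
     rewrite /= two_steps_neq.
have nRa1 a : ~ R (Mn_atom a, Mn_top) by move=> /Rc /nRa0.
have nR01 : ~ R (Mn_bot, Mn_top) by move=> /Rc.
have Rfun a b b' : R (Mn_atom a, Mn_atom b) -> R (Mn_atom a, Mn_atom b') -> b = b'.
  (* Two distinct partners of a would join to 1, giving the excluded pair (a,1). *)
  move=> Rb Rb'; apply/eqP; case: eqP => // /eqP nbb'.
  by case: (nRa1 a); have := Rj _ _ Rb Rb'; rewrite /= eqxx (negPf nbb').
have [[i0 at0]|noat] := classic (exists i, is_atom (s i)).
  have [a sa] : exists a, s i0 = Mn_atom a by case: (s i0) at0 => // a; exists a.
  have [b tb] : exists b, t i0 = Mn_atom b.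
    by move: (Rst i0); rewrite sa; case: (t i0) => [/nRa0|/nRa1|b _] //; exists b.
  have Rab : R (Mn_atom a, Mn_atom b) by rewrite -sa -tb.
  (* Complementing (a,b) a'-a times gives (a', b+a'-a), and a' has only one partner. *)
  exists (b - a)%R => i; move: (Rst i).
  case: (s i) (t i) => [||a'] [||b'] //= Ri.
  - by case: (nR0a b').
  - by case: (nR1a b').
  - by case: (nRa0 a').
  - by case: (nRa1 a').
  have := subuniverse_iter_compl (a' - a)%R sR Rab.
  have -> (d : nat) x y : iter d (@compl (product2 (Mn n) (Mn n))) (x, y)
      = (iter d (@compl (Mn n)) x, iter d (@compl (Mn n)) y).
    by elim: d => //= d ->.
  rewrite !iter_compl_atom ord_natr [(a + _)%R]addrC subrK => /(Rfun _ _ _ Ri) ->.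
  by rewrite addrCA.
(* Without atoms in [s], the excluded pairs force [t] and [s] to agree. *)
exists 0%R => i; rewrite Mn_shift0; move: (Rst i).
case si: (s i) (t i) => [||a] [||b] // Ri.
- by case: (nR0a b).
- by case: (nR1a b).
all: by case: noat; exists i; rewrite si.
Qed.

(** * Assignments, their orbits under shifts, and the orbit count *)

Section Assignments.

Variable k : nat.
Implicit Types f : {ffun 'I_k -> Mn_carrier n}.

Definition nonboolean f := [exists i, is_atom (f i)].

(* The pick depends only on which values of [f] are atoms, hence [pivot] is
   equivariant under shifts and each orbit of nonboolean assignments contains
   exactly one with [pivot f = 0]. *)
Definition pivot f : 'I_n :=
  if [pick i | is_atom (f i)] is Some i then
    if f i is Mn_atom a then a else 0%R
  else 0%R.

Definition shift c f : {ffun 'I_k -> Mn_carrier n} := [ffun i => Mn_shift c (f i)].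

Lemma nonboolean_shift c f : nonboolean (shift c f) = nonboolean f.
Proof. by apply: eq_existsb => i; rewrite ffunE is_atom_shift. Qed.

Lemma shiftD b c f : shift c (shift b f) = shift (b + c)%R f.
Proof. by apply/ffunP => i; rewrite !ffunE Mn_shiftD. Qed.

Lemma shift0 f : shift 0%R f = f.
Proof. by apply/ffunP => i; rewrite !ffunE Mn_shift0. Qed.

Lemma pivot_shift c f : nonboolean f -> pivot (shift c f) = (pivot f + c)%R.
Proof.
move=> /existsP nf; rewrite /pivot.
have -> : [pick i | is_atom (shift c f i)] = [pick i | is_atom (f i)].
  by apply: eq_pick => i; rewrite ffunE is_atom_shift.
case: pickP => [i|noat]; last by case: nf => i; rewrite noat.
by rewrite ffunE; case: (f i).
Qed.

Definition normalized f := nonboolean f && (pivot f == 0%R).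

Lemma normalized_shift f :
  nonboolean f -> normalized (shift (- pivot f)%R f).
Proof.
move=> nf; rewrite /normalized nonboolean_shift nf pivot_shift // addrN.
by rewrite eqxx.
Qed.

Definition orbit_rep := {f | normalized f}.

(** The remaining assignments are exactly the images of the 2^k maps into [bool]. *)
Lemma card_nonboolean : #|nonboolean| = (n + 2) ^ k - 2 ^ k.
Proof.
have -> : (n + 2) ^ k = #|{: {ffun 'I_k -> Mn_carrier n}}|.
  by rewrite card_ffun card_Mn card_ord.
rewrite -(cardC nonboolean).
pose tob (u : {ffun 'I_k -> bool}) : {ffun 'I_k -> Mn_carrier n} :=
  [ffun i => Mn_of_bool n (u i)].
have tob_inj : injective tob.
  move=> u v /ffunP uv; apply/ffunP => i.
  by have := uv i; rewrite !ffunE => /Mn_of_bool_inj.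
suff -> : #|[predC nonboolean]| = 2 ^ k by rewrite addnK.
transitivity #|codom tob|.
  apply: eq_card => f; rewrite !inE; apply/idP/codomP => [|[u ->]].
    rewrite negb_exists => /forallP nf.
    exists [ffun i => f i == Mn_top]; apply/ffunP => i; rewrite !ffunE.
    by rewrite Mn_of_boolK.
  by rewrite negb_exists; apply/forallP => i; rewrite ffunE; case: (u i).
by rewrite card_codom // card_ffun card_bool card_ord.
Qed.

(** Each nonboolean assignment is a unique shift of a unique representative. The product form also
    yields divisibility by n. *)
Lemma card_orbit_rep : #|{: orbit_rep}| * n = (n + 2) ^ k - 2 ^ k.
Proof.
rewrite -card_nonboolean.
transitivity #|{: orbit_rep * 'I_n}|; first by rewrite card_prod card_ord.
pose F (p : orbit_rep * 'I_n) := shift p.2 (val p.1).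
have F_inj : injective F.
  move=> [[f Nf] c] [[f' Nf'] c'] /= E.
  have /andP[nf /eqP pf] : normalized f by [].
  have /andP[nf' /eqP pf'] : normalized f' by [].
  rewrite /F /= in E.
  (* Representatives have pivot 0, so the pivot of the shifted assignment recovers the shift. *)
  have := congr1 pivot E; rewrite !pivot_shift // pf pf' !add0r => cc'.
  subst c'; congr pair; apply: val_inj => /=.
  by rewrite -(shift0 f) -(shift0 f') -(addrN c) -!shiftD E.
rewrite -(card_codom F_inj); apply: eq_card => f; apply/codomP/idP.
  case=> [[g c] ->]; have /andP[ng _] := valP g.
  by rewrite -[_ \in _]/(nonboolean (shift c (val g))) nonboolean_shift.
rewrite -[_ \in _]/(nonboolean f) => nf; exists (exist normalized _ (normalized_shift nf), pivot f).
by rewrite /F /= shiftD addNr shift0.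
Qed.

(** * The explicit free algebra *)

Definition free_model : algebra :=
  product2 (product (fun _ : orbit_rep => Mn n))
           (product (fun _ : {ffun 'I_k -> bool} => two)).

Definition free_gen (i : 'I_k) : free_model := (fun f : orbit_rep => val f i, fun u : {ffun _ -> bool} => u i).

Definition assignment (j : orbit_rep + {ffun 'I_k -> bool}) :
    {ffun 'I_k -> Mn_carrier n} :=
  match j with
  | inl f => val f
  | inr u => [ffun i => Mn_of_bool n (u i)]
  end.

(** Boolean coordinates are embedded into [Mn n], so that all coordinates take values in one
    algebra, as the separation argument requires. *)
Definition eval (j : orbit_rep + {ffun 'I_k -> bool}) (p : free_model) : Mn n :=
  match j with
  | inl f => p.1 f
  | inr u => Mn_of_bool n (p.2 u)
  end.

Lemma eval_hom j : hom (eval j).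
Proof.
case: j => [f|u]; first by [].
have h : hom (A := free_model) (B := two) (fun p => p.2 u) by [].
exact: comp_hom h (Mn_of_bool_hom n).
Qed.

Lemma eval_gen j i : eval j (free_gen i) = assignment j i.
Proof. by case: j => [f|u] //=; rewrite ffunE. Qed.

Lemma eval_inj (a b : free_model) : (forall j, eval j a = eval j b) -> a = b.
Proof.
case: a b => [a a'] [b b'] E; congr pair.
  by apply: functional_extensionality => f; apply: (E (inl f)).
by apply: functional_extensionality => u; apply: Mn_of_bool_inj (E (inr u)).
Qed.

Lemma nonboolean_inr u : nonboolean (assignment (inr u)) = false.
Proof. by apply/existsP => -[i]; rewrite ffunE; case: (u i). Qed.

(** Zero pivots force c = 0 between representatives, shifts preserve being nonboolean, and they fix
    Boolean assignments. *)
Lemma assignment_shift_inj c j l :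
  assignment l = shift c (assignment j) -> j = l.
Proof.
case: j l => [f|u] [f'|u'] E.
- have /andP[nf /eqP pf] := valP f; have /andP[_ /eqP pf'] := valP f'.
  have := congr1 pivot E; rewrite /= pivot_shift // pf pf' add0r => c0.
  by move: E; rewrite -c0 shift0 => /val_inj ->.
- have := nonboolean_inr u'; rewrite E nonboolean_shift.
  by have /andP[-> _] := valP f.
- have /andP[] := valP f'; rewrite -[val f']/(assignment (inl f')) E.
  by rewrite nonboolean_shift nonboolean_inr.
- congr inr; apply/ffunP => i; apply: (@Mn_of_bool_inj n).
  by move/ffunP: E => /(_ i); rewrite !ffunE; case: (u i).
Qed.

Lemma free_gen_generates : generates free_gen.
Proof.
move=> S sS Sg; apply: (separating_subuniverse_full (ev := eval) _ _ _ sS).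
- exact: Mn_lattice_with_complementation.
- exact: eval_hom.
- exact: eval_inj.
- move=> j l njl.
  (* Apply [separation] to the projection of [S] on coordinates [j] and [l]; distinct coordinates
     are never shifts of each other. *)
  have sR := subuniverse_image (hom_pair (eval_hom j) (eval_hom l)) sS.
  have [|[e Se [ej el]]|[c Ec]] := separation (s := assignment j)
      (t := assignment l) sR.
  + by move=> i; exists (free_gen i); rewrite ?eval_gen.
  + by exists e.
  + case/eqP: njl; apply: (@assignment_shift_inj c).
    by apply/ffunP => i; rewrite ffunE.
(* A Boolean coordinate takes only the values 0 and 1; at a representative some generator evaluates
   to an atom, which generates [Mn n]. *)
- case=> [f|u] a; last first.
    exists (if a.2 u then top else bot).
      by case: (a.2 u); [apply: sub_top | apply: sub_bot].
    by case E: (a.2 u); rewrite /= E.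
  have /andP[/existsP[i at_i] _] := valP f.
  have sR := subuniverse_image (eval_hom (inl f)) sS.
  have [b fb] : exists b, val f i = Mn_atom b.
    by case: (val f i) at_i => // b; exists b.
  by apply: (atom_generates sR (a := b)); exists (free_gen i).
Qed.

Lemma free_gen_extends : extends_to free_gen (Mn n).
Proof.
move=> f; pose f0 : {ffun 'I_k -> Mn_carrier n} := finfun f.
have [nf|bf] := boolP (nonboolean f0).
  (* Evaluate at the representative of the orbit of [f0], then undo the normalizing shift. *)
  pose r : orbit_rep := exist normalized _ (normalized_shift nf).
  exists (Mn_shift (pivot f0) \o eval (inl r)); split.
    exact: comp_hom (eval_hom _) (Mn_shift_hom _).
  by move=> i; rewrite /= !ffunE Mn_shiftD addNr Mn_shift0.
pose u : {ffun 'I_k -> bool} := [ffun i => f0 i == Mn_top].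
exists (eval (inr u)); split; first exact: eval_hom.
move=> i; rewrite eval_gen /= !ffunE Mn_of_boolK //.
by move: bf; rewrite negb_exists => /forallP/(_ i); rewrite ffunE.
Qed.

Lemma free_model_variety : variety_generated_by (Mn n) free_model.
Proof.
move=> K vK KM; apply: variety_product2 => //; apply: variety_P => // _.
(* [two] embeds in [Mn n] as {0,1}. *)
exact: variety_S vK _ _ _ (Mn_of_bool_hom n) (@Mn_of_bool_inj n) KM.
Qed.

Lemma free_model_free :
  freely_generated (variety_generated_by (Mn n)) free_gen.
Proof.
apply: freely_generated_variety; [exact: free_model_variety| |].
  exact: free_gen_generates.
exact: free_gen_extends.
Qed.

Lemma free_model_isomorphic :
  isomorphic free_model
    (product2 (power (Mn n) (((n + 2) ^ k - 2 ^ k) %/ n)) (power two (2 ^ k))).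
Proof.
apply: isomorphic_product2; apply: isomorphic_power.
  by rewrite -card_orbit_rep mulnK.
by rewrite card_ffun card_bool card_ord.
Qed.

End Assignments.

End Shift.

Theorem theorem6p7 (n : nat) (hn : 3 <= n) :
  (forall k : nat, 1 <= k ->
     [/\ n %| (n + 2) ^ k - 2 ^ k,
         exists (F : algebra) (g : 'I_k -> F),
           freely_generated (variety_generated_by (Mn n)) g
       & forall (F : algebra) (g : 'I_k -> F),
           freely_generated (variety_generated_by (Mn n)) g ->
           isomorphic F
             (product2 (power (Mn n) (((n + 2) ^ k - 2 ^ k) %/ n))
                       (power two (2 ^ k)))])
  /\ (forall (F : algebra) (g : 'I_1 -> F),
        freely_generated (variety_generated_by (Mn n)) g ->
        isomorphic F (product2 (Mn n) (power two 2))).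
Proof.
case: n hn => [|[|[|m]]] // _.
have iso k (F : algebra) (g : 'I_k -> F) :
    freely_generated (variety_generated_by (Mn m.+3)) g ->
    isomorphic F (product2 (power (Mn m.+3) (((m.+3 + 2) ^ k - 2 ^ k) %/ m.+3))
                           (power two (2 ^ k))).
  move=> Fg; apply: isomorphic_trans (free_model_isomorphic m k).
  exact: free_unique Fg (free_model_free m k).
split=> [k _|F g Fg].
  split; [by rewrite -card_orbit_rep dvdn_mull | | exact: iso].
  by exists (free_model m k), (@free_gen m k); apply: free_model_free.
apply: isomorphic_trans (iso 1 F g Fg) _.
(* For k = 1 the exponent is (n+2-2)/n = 1. *)
rewrite !expn1 addnK divnn /=.
by apply: isomorphic_product2; [apply: isomorphic_power1 | apply: isomorphic_refl].
Qed.
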